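(* Let $\mathcal{P}\subset\mathbb{R}^s$ be a rational polytope and let $h(a)=\prod_{i=1}^{s+1}\sum_{j=1}^{k_i}P_{ij}(a_i)\gamma_{ij}^{a_i}$, where the $P_{ij}$ are polynomials and the $\gamma_{ij}$ are nonzero complex numbers. Then $F_{\mathcal{P}}^{s,h}(t,x)$ and $F_{\mathcal{P}^{\circ}}^{s,h}(t,x)$ are rational $s$-weighted multivariate Ehrhart series (that is, they are rational functions), and they satisfy the reciprocity relation $$F_{\mathcal{P}}^{s,h}(t^{-1},x^{-1})=(-1)^{s+1}F_{\mathcal{P}^{\circ}}^{s,h}(t,x).$$
   Context: For a convex rational polytope $\mathcal{P}\subset\mathbb{R}^s$, $\mathrm{cone}(\mathcal{P})$ is the polyhedral cone in $\mathbb{R}^{s+1}$ generated by $\{(x,1):x\in\mathcal{P}\cap\mathbb{Z}^s\}$, and $\mathrm{cone}(\mathcal{P})^{\circ}$ is its interior. For $a=(a_1,\ldots,a_{s+1})\in\mathbb{Z}^{s+1}$ write $t^a=t_1^{a_1}\cdots t_s^{a_s}$ and $\phi(a)=a_{s+1}$. The $s$-weighted multivariate Ehrhart series and the interior $s$-weighted Ehrhart series for the weight function $h$ are $$F_{\mathcal{P}}^{s,h}(t,x)=\sum_{a\in\mathrm{cone}(\mathcal{P})\cap\mathbb{Z}^{s+1}}h(a)t^ax^{\phi(a)},\qquad F_{\mathcal{P}^{\circ}}^{s,h}(t,x)=\sum_{a\in\mathrm{cone}(\mathcal{P})^{\circ}\cap\mathbb{Z}^{s+1}}h(-a)t^ax^{\phi(a)}.$$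 In the reciprocity relation the series are identified with the rational functions they represent, and $t^{-1}=(t_1^{-1},\ldots,t_s^{-1})$. The superscript $s$ only names the type of weighting.
   Formalization: The reciprocity relation (not the rationality) is stated under the added assumption that cone(P) has nonempty interior; without it the relation fails, e.g. for P={0} in R^1 and h=1, where F=1/(1-x) but the interior series is 0. *)

(* Defs.v *)
From mathcomp Require Import all_boot all_order all_algebra.
From mathcomp Require Import generic_quotient fraction complex.
From mathcomp Require Import all_classical all_reals all_analysis.
(* The notations of mpoly clash with those of all_analysis. *)
From mathcomp Require Import -(notations) mpoly.

Set Implicit Arguments.
Unset Strict Implicit.
Unset Printing Implicit Defensive.

Import GRing.Theory Num.Theory.
Import numFieldNormedType.Exports.

Local Open Scope classical_set_scope.
Local Open Scope ring_scope.

Section Polyhedra.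
Variable R : realType.

Definition int_point (n : nat) (a : 'rV[int]_n) : 'rV[R]_n := map_mx intr a.

Definition convex_hull (n m : nat) (v : 'I_m -> 'rV[R]_n) : set 'rV[R]_n :=
  [set x | exists l : 'I_m -> R,
     [/\ forall i, 0 <= l i, \sum_i l i = 1 & x = \sum_i l i *: v i]].

Definition rational_polytope (n : nat) (P : set 'rV[R]_n) : Prop :=
  exists (m : nat) (v : 'I_m -> 'rV[rat]_n),
    P = convex_hull (fun i => map_mx ratr (v i)).

Definition conic_hull (n : nat) (S : set 'rV[R]_n) : set 'rV[R]_n :=
  [set x | exists (m : nat) (l : 'I_m -> R) (y : 'I_m -> 'rV[R]_n),
     [/\ forall i, 0 <= l i, forall i, S (y i) & x = \sum_i l i *: y i]].

(* Only the lattice points of P enter, also when P is not a lattice polytope. *)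
Definition cone (s : nat) (P : set 'rV[R]_s) : set 'rV[R]_(s + 1) :=
  conic_hull [set row_mx (int_point a) (const_mx 1) |
               a in [set a : 'rV[int]_s | P (int_point a)]].

End Polyhedra.

Section Series.
Variables (C : fieldType) (n : nat).

Local Notation "p %:F" := (@FracField.tofrac (mpoly n C) p).

(* f stands for \sum_a f(a) z^a, where a ranges over Z^n and
   z = (z_1, ..., z_n). *)
Definition formal_series : Type := 'rV[int]_n -> C.

Definition int_expo (m : multinom n) : 'rV[int]_n := \row_i (m i)%:Z.

Definition series_of_mpoly (p : mpoly n C) : formal_series :=
  fun b => \sum_(m <- msupp p | int_expo m == b) mcoeff m p.

Definition mpoly_mul_series (q : mpoly n C) (f : formal_series) :
    formal_series :=
  fun b => \sum_(m <- msupp q) mcoeff m q * f (b - int_expo m).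

(* Numerator and denominator may be taken polynomial rather than Laurent, after
   multiplying both by a monomial.  A series f represents at most one r: from
   q f = p and q' f = p' follows q' p = q p'. *)
Definition represents (f : formal_series) (r : {fraction (mpoly n C)}) : Prop :=
  exists p q : mpoly n C,
    [/\ q != 0, mpoly_mul_series q f = series_of_mpoly p & r = p%:F / q%:F].

Definition is_rational (f : formal_series) : Prop :=
  exists r, represents f r.

Definition mpoly_subst_inv (p : mpoly n C) : {fraction (mpoly n C)} :=
  mmap (fun c : C => (mpolyC n c)%:F) (fun i => ((mpolyX C (mnm1 i))%:F)^-1) p.

(* r(z_1^-1, ..., z_n^-1).  The substitution is an injective ring morphism on
   polynomials, so the choice of the fraction repr r is immaterial. *)
Definition subst_inv (r : {fraction (mpoly n C)}) : {fraction (mpoly n C)} :=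
  mpoly_subst_inv (frac (repr r)).1 / mpoly_subst_inv (frac (repr r)).2.

Definition exp_poly_weight (k : 'I_n -> nat)
    (p : forall i, 'I_(k i) -> {poly C}) (g : forall i, 'I_(k i) -> C) :
    'rV[int]_n -> C :=
  fun a => \prod_(i < n) \sum_(j < k i)
             (p i j).[(a 0 i)%:~R] * g i j ^ (a 0 i).

End Series.

(* The s + 1 variables are z = (t_1, ..., t_s, x), so that t^a x^(phi a) is the
   monomial z^a. *)
Section Ehrhart.
Variables (R : realType) (s : nat).
Variables (P : set 'rV[R]_s) (h : 'rV[int]_(s + 1) -> R[i]).

Definition ehrhart_series : formal_series R[i] (s + 1) :=
  fun a => if int_point R a \in cone P then h a else 0.

Definition interior_ehrhart_series : formal_series R[i] (s + 1) :=
  fun a => if int_point R a \in (interior (cone P) : set 'rV[R]_(s + 1))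
           then h (- a) else 0.

End Ehrhart.

(* Main.v *)
Require Import Defs.
From mathcomp Require Import all_boot all_order all_algebra.
From mathcomp Require Import generic_quotient fraction complex.
From mathcomp Require Import all_classical all_reals all_analysis.
From mathcomp Require Import -(notations) mpoly.
From mathcomp Require Import zify ring lra.

Set Implicit Arguments.
Unset Strict Implicit.
Unset Printing Implicit Defensive.

Import Order.TTheory GRing.Theory Num.Theory.
Import numFieldNormedType.Exports.

Local Open Scope classical_set_scope.
Local Open Scope ring_scope.

(** The argument takes place in the module of all functions on Z^n, n = s + 1,
    over the polynomial ring, where two submodules matter: the rational series
    (some nonzero polynomial makes them finitely supported) and the torsion
    series (some nonzero polynomial annihilates them).  A function invariant under
    a translation u is torsion, since 1 - z^u annihilates it.

    Let K be the cone of P.  Reflecting the interior series shows that reciprocity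
    means that h(a) (1_K(a) - (-1)^n 1_(-K^o)(a)) is torsion, K^o being the
    interior of K.  Both submodules are stable under multiplication by a_i (the
    derivation z_i d/dz_i) and by c^(a_i) (the substitution z_i -> c z_i), hence
    by the weight h (admissible_exp_poly), and it suffices to treat the indicator
    functions 1_K and 1_(-K^o).

    P has finitely many lattice points, so Fourier-Motzkin elimination gives
    integer linear forms l_1, ..., l_m with K = {l_j >= 0 for all j} and
    K^o = {l_j > 0 for all j} (cone_hyperplanes).  K and -K^o are thus the regions
    of the sign vectors (+, ..., +) and (-, ..., -) in the arrangement of the l_j,
    where + stands for l_j >= 0 and - for l_j < 0.

    No triangulation of K is needed; one proves more for all the regions of
    the arrangement, by induction on m (region_rational, region_reciprocity).  The
    sum of the regions of two sign vectors that differ at j only is a region of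
    the arrangement without l_j.  So by induction changing a sign changes, up to
    sign and modulo the submodule, neither a region nor the difference of a region
    and (-1)^n times the opposite one.  If the l_j satisfy a linear relation, the
    region of the signs of its coefficients is empty; for the difference, the
    opposite region is empty as well because a point of K^o forces coefficients
    of both signs.  Hence everything vanishes modulo the submodule.  If the l_j
    are independent and m < n, the regions are unions of parallel lines,
    hence torsion.
    There remains the simplicial case m = n, where regions are rational by a
    product formula, and where going from a region to its opposite takes n sign
    changes, each of which costs a factor -1 modulo torsion.

    Finally, an equation q f = p becomes an equation for the reflected series
    after reversing p and q, which is the effect of inverting the variables in
    p / q (subst_inv_represents). *)

(** * Rational series, torsion series and weights *)

Section SeriesModule.
Variables (C : fieldType) (n : nat).
Implicit Types (p q : mpoly n C) (f g : formal_series C n) (a b v : 'rV[int]_n).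

Lemma int_expoD (m1 m2 : multinom n) :
  int_expo (mnm_add m1 m2) = int_expo m1 + int_expo m2.
Proof. by apply/rowP => i; rewrite !mxE mnmDE PoszD. Qed.

Lemma int_expo_inj : injective (@int_expo n).
Proof.
move=> m1 m2 /rowP e; apply/mnmP => i.
by have := e i; rewrite !mxE => -[].
Qed.

(** The nonnegative part of an integer vector; v is the difference of those of
    v and -v, which turns Laurent monomials into quotients of monomials. *)
Definition pos_expo (a : 'rV[int]_n) : multinom n :=
  Multinom [tuple if 0 <= a 0 i then absz (a 0 i) else 0%N | i < n].

Lemma mul_series_widen q f b (s : seq (multinom n)) :
  uniq s -> {subset msupp q <= s} ->
  mpoly_mul_series q f b = \sum_(m <- s) mcoeff m q * f (b - int_expo m).
Proof.
move=> us sub; rewrite /mpoly_mul_series [RHS](bigID (mem (msupp q)) predT) /=.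
rewrite [X in _ = _ + X]big1 ?addr0; last first.
  by move=> m /memN_msupp_eq0 ->; rewrite mul0r.
rewrite -[RHS]big_filter; apply: perm_big; apply: uniq_perm.
- exact: msupp_uniq.
- exact: filter_uniq.
move=> m; rewrite mem_filter /=; case: (boolP (m \in msupp q)) => //= mq.
by rewrite sub.
Qed.

Lemma mul_seriesDl p q f b :
  mpoly_mul_series (p + q) f b = mpoly_mul_series p f b + mpoly_mul_series q f b.
Proof.
pose s := undup (msupp p ++ msupp q).
have us : uniq s by exact: undup_uniq.
rewrite !(@mul_series_widen _ _ _ s) //; try by
  move=> m mp; rewrite mem_undup mem_cat mp ?orbT.
  by rewrite -big_split; apply: eq_bigr => m _; rewrite mcoeffD mulrDl.
by move=> m /msuppD_le; rewrite mem_undup.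
Qed.

Lemma mul_seriesZX c (m : multinom n) f b :
  mpoly_mul_series (c *: mpolyX C m) f b = c * f (b - int_expo m).
Proof.
rewrite (@mul_series_widen _ _ _ [:: m]) //.
  by rewrite big_seq1 mcoeffZ mcoeffX eqxx mulr1.
by move=> k /msuppZ_le; rewrite msuppX.
Qed.

Lemma mul_series_sum (I : Type) (s : seq I) (F : I -> mpoly n C) f b :
  mpoly_mul_series (\sum_(i <- s) F i) f b =
  \sum_(i <- s) mpoly_mul_series (F i) f b.
Proof.
elim: s => [|i s IH]; last by rewrite !big_cons mul_seriesDl IH.
by rewrite !big_nil /mpoly_mul_series msupp0 big_nil.
Qed.

Lemma mul_series_monomials (I : Type) (s : seq I) (c : I -> C)
    (e : I -> multinom n) f b :
  mpoly_mul_series (\sum_(i <- s) c i *: mpolyX C (e i)) f b =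
  \sum_(i <- s) c i * f (b - int_expo (e i)).
Proof.
by rewrite mul_series_sum; apply: eq_bigr => i _; rewrite mul_seriesZX.
Qed.

Lemma mul_seriesA p q f :
  mpoly_mul_series (p * q) f = mpoly_mul_series p (mpoly_mul_series q f).
Proof.
apply/funext => b.
have -> : p * q = \sum_(m <- msupp p) \sum_(m' <- msupp q)
    (mcoeff m p * mcoeff m' q) *: mpolyX C (mnm_add m m').
  rewrite {1}(mpolyE p) {1}(mpolyE q) mulr_suml; apply: eq_bigr => m _.
  rewrite mulr_sumr; apply: eq_bigr => m' _.
  by rewrite -scalerAl -scalerAr scalerA mpolyXD.
rewrite mul_series_sum {2}/mpoly_mul_series; apply: eq_bigr => m _.
rewrite mul_series_monomials mulr_sumr; apply: eq_bigr => m' _.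
by rewrite mulrA int_expoD opprD addrA.
Qed.

Lemma mul_seriesC p q f :
  mpoly_mul_series p (mpoly_mul_series q f) =
  mpoly_mul_series q (mpoly_mul_series p f).
Proof. by rewrite -!mul_seriesA mulrC. Qed.

Lemma mul_series_lin q c f g :
  mpoly_mul_series q (fun a => c * f a + g a) =
  (fun a => c * mpoly_mul_series q f a + mpoly_mul_series q g a).
Proof.
apply/funext => b; rewrite /mpoly_mul_series mulr_sumr -big_split.
by apply: eq_bigr => m _ /=; ring.
Qed.

(** Writing a polynomial as a product with the unit series lets associativity
    speak of products of polynomials too. *)
Lemma series_of_mpolyE p :
  series_of_mpoly p = mpoly_mul_series p (fun a => (a == 0)%:R).
Proof.
apply/funext => b; rewrite /series_of_mpoly /mpoly_mul_series big_mkcond.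
apply: eq_bigr => m _; rewrite subr_eq0 eq_sym.
by case: eqP; rewrite ?mulr1 ?mulr0.
Qed.

Lemma mul_series_of_mpoly p q :
  mpoly_mul_series q (series_of_mpoly p) = series_of_mpoly (q * p).
Proof. by rewrite !series_of_mpolyE mul_seriesA. Qed.

Lemma series_of_mpoly_inj : injective (@series_of_mpoly C n).
Proof.
suff coefE p m : series_of_mpoly p (int_expo m) = mcoeff m p.
  by move=> p q e; apply/mpolyP => m; rewrite -!coefE e.
rewrite /series_of_mpoly; under eq_bigl do rewrite (inj_eq int_expo_inj).
have [mp|/memN_msupp_eq0 m0] := boolP (m \in msupp p).
  by rewrite -big_filter filter_pred1_uniq ?msupp_uniq // big_seq1.
by rewrite m0 big1 // => k /eqP ->.
Qed.

(** The series supported on a finite set if [fin], and the zero series alone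
    otherwise: the list of the support is the common form under which both
    classes are closed by the same proofs. *)
Definition trivial_series (fin : bool) f : Prop :=
  exists s : seq 'rV[int]_n,
    (fin \/ s = [::]) /\ forall a, a \notin s -> f a = 0.

Lemma trivial_series_mul fin q f :
  trivial_series fin f -> trivial_series fin (mpoly_mul_series q f).
Proof.
move=> [s [fs f0]].
exists [seq x + int_expo m | x <- s, m <- msupp q]; split.
  by case: fs => [|->]; [left|right].
move=> a as'; rewrite /mpoly_mul_series big_seq big1 // => m mq.
rewrite f0 ?mulr0 //; apply: contra as' => aq.
by apply/allpairsP; exists (a - int_expo m, m) => /=; rewrite subrK; split.
Qed.

Lemma trivial_series_lin fin (w1 w2 : 'rV[int]_n -> C) f g :
  trivial_series fin f -> trivial_series fin g ->
  trivial_series fin (fun a => w1 a * f a + w2 a * g a).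
Proof.
move=> [s [fs f0]] [s' [fs' g0]]; exists (s ++ s'); split.
  by case: fs => [?|->]; [left|case: fs' => [?|->]; [left|right]].
by move=> a; rewrite mem_cat negb_or => /andP[/f0 -> /g0 ->]; rewrite !mulr0 addr0.
Qed.

(** The rational series if [fin], and the torsion series, which represent the
    fraction 0, otherwise.  Rationality is an equation modulo the first module
    and reciprocity an equation modulo the second. *)
Definition quasi_trivial (fin : bool) f : Prop :=
  exists2 q : mpoly n C, q != 0 & trivial_series fin (mpoly_mul_series q f).

Lemma quasi_trivial_of_trivial fin f : trivial_series fin f -> quasi_trivial fin f.
Proof.
move=> tf; exists 1; first exact: oner_neq0.
suff -> : mpoly_mul_series 1 f = f by [].
apply/funext => b; rewrite /mpoly_mul_series msupp1 big_seq1 mcoeff1 eqxx mul1r.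
by congr f; apply/rowP => i; rewrite !mxE mnm0E subr0.
Qed.

Lemma quasi_trivial0 fin : quasi_trivial fin (fun=> 0).
Proof. by apply: quasi_trivial_of_trivial; exists [::]; split=> //; right. Qed.

Lemma quasi_trivial_lin fin c f g :
  quasi_trivial fin f -> quasi_trivial fin g ->
  quasi_trivial fin (fun a => c * f a + g a).
Proof.
move=> [q q0 tf] [r r0 tg]; exists (r * q); first exact: mulf_neq0.
rewrite mul_series_lin !mul_seriesA (mul_seriesC r q g).
have := trivial_series_lin (fun=> c) (fun=> 1) (trivial_series_mul r tf)
  (trivial_series_mul q tg).
by under [X in trivial_series _ X]eq_fun do rewrite mul1r.
Qed.

Lemma quasi_trivialZ fin c f :
  quasi_trivial fin f -> quasi_trivial fin (fun a => c * f a).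
Proof.
move=> qf; have := quasi_trivial_lin c qf (quasi_trivial0 fin).
by under [X in quasi_trivial _ X]eq_fun do rewrite addr0.
Qed.

(** The difference is the product with the Laurent binomial 1 - z^v, which
    becomes a polynomial after multiplication by the monomial of the negative
    part of v and can then be absorbed in the denominator. *)
Lemma quasi_trivial_diff fin f v : v != 0 ->
  quasi_trivial fin (fun a => f a - f (a - v)) -> quasi_trivial fin f.
Proof.
move=> v0 [q q0 tf].
have vE : v = int_expo (pos_expo v) - int_expo (pos_expo (- v)).
  by apply/rowP => i; rewrite !mxE !mnmE !mxE; case: ifP; case: ifP; move: (v 0 i) => x; lia.
exists (q * (mpolyX C (pos_expo (- v)) - mpolyX C (pos_expo v))).
  rewrite mulf_neq0 // subr_eq0; apply: contraNneq v0 => e.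
  have := congr1 (mcoeff (pos_expo v)) e; rewrite !mcoeffX eqxx.
  case: eqP => [e' _|_ /eqP]; last by rewrite eq_sym oner_eq0.
  by rewrite vE e' subrr.
set d := fun a => _ in tf.
suff -> : mpoly_mul_series (q * (mpolyX C (pos_expo (- v)) - mpolyX C (pos_expo v))) f =
    mpoly_mul_series (mpolyX C (pos_expo (- v))) (mpoly_mul_series q d).
  exact: trivial_series_mul.
rewrite mul_seriesA [RHS]mul_seriesC.
congr mpoly_mul_series; apply/funext => b.
have shiftE e f' : mpoly_mul_series (mpolyX C e) f' b = f' (b - int_expo e).
  by rewrite -[mpolyX C e]scale1r mul_seriesZX mul1r.
have shiftNE e f' : mpoly_mul_series (- mpolyX C e) f' b = - f' (b - int_expo e).
  by rewrite -scaleN1r mul_seriesZX mulN1r.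
rewrite mul_seriesDl shiftNE !shiftE /d; congr (_ - f _).
move: (int_expo (pos_expo v)) (int_expo (pos_expo (- v))) vE => x y ->.
by rewrite opprB addrA subrK.
Qed.

(** Admissible weights are those that reduce a statement modulo one of the two
    modules to the same statement with weight 1; they form a ring. *)
Definition admissible fin (w : 'rV[int]_n -> C) : Prop :=
  forall f, quasi_trivial fin f -> quasi_trivial fin (fun a => w a * f a).

Lemma admissible_cst fin c : admissible fin (fun=> c).
Proof. by move=> f; exact: quasi_trivialZ. Qed.

Lemma admissibleD fin w1 w2 : admissible fin w1 -> admissible fin w2 ->
  admissible fin (fun a => w1 a + w2 a).
Proof.
move=> a1 a2 f qf; have := quasi_trivial_lin 1 (a1 _ qf) (a2 _ qf).
by under [X in quasi_trivial _ X -> _]eq_fun do rewrite mul1r -mulrDl.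
Qed.

Lemma admissibleM fin w1 w2 : admissible fin w1 -> admissible fin w2 ->
  admissible fin (fun a => w1 a * w2 a).
Proof.
move=> a1 a2 f qf; have := a1 _ (a2 _ qf).
by under [X in quasi_trivial _ X -> _]eq_fun do rewrite mulrA.
Qed.

Lemma admissible_sum fin (I : Type) (s : seq I) (w : I -> 'rV[int]_n -> C) :
  (forall i, admissible fin (w i)) ->
  admissible fin (fun a => \sum_(i <- s) w i a).
Proof.
move=> aw; elim: s => [|i s IH].
  by under eq_fun do rewrite big_nil; exact: admissible_cst.
by under eq_fun do rewrite big_cons; exact: admissibleD.
Qed.

Lemma admissible_prod fin (I : Type) (s : seq I) (w : I -> 'rV[int]_n -> C) :
  (forall i, admissible fin (w i)) ->
  admissible fin (fun a => \prod_(i <- s) w i a).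
Proof.
move=> aw; elim: s => [|i s IH].
  by under eq_fun do rewrite big_nil; exact: admissible_cst.
by under eq_fun do rewrite big_cons; exact: admissibleM.
Qed.

Lemma admissibleX fin w (k : nat) : admissible fin w ->
  admissible fin (fun a => w a ^+ k).
Proof.
move=> aw; elim: k => [|k IH].
  by under eq_fun do rewrite expr0; exact: admissible_cst.
by under eq_fun do rewrite exprS; exact: admissibleM.
Qed.

(** Scaling by a_i acts as the derivation D = z_i d/dz_i: if q f = g then
    q^2 (D f) = q (D g) - (D q) g. *)
Lemma admissible_coord fin i : admissible fin (fun a => (a 0 i)%:~R).
Proof.
move=> f [q q0 tf]; exists (q * q); first exact: mulf_neq0.
pose Dq : mpoly n C :=
  \sum_(m <- msupp q) ((m i)%:R * mcoeff m q) *: mpolyX C m.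
set g := mpoly_mul_series q f in tf *.
set Df := fun a => _.
have leibniz b : mpoly_mul_series q Df b = (b 0 i)%:~R * g b - mpoly_mul_series Dq f b.
  rewrite mul_series_monomials /g /mpoly_mul_series mulr_sumr -sumrB.
  by apply: eq_bigr => m _; rewrite /Df !mxE rmorphB /=; ring.
have -> : mpoly_mul_series (q * q) Df = (fun b =>
    1 * mpoly_mul_series q (fun a => (a 0 i)%:~R * g a + 0 * g a) b
    + (-1) * mpoly_mul_series Dq g b).
  rewrite mul_seriesA [in RHS]/g; apply/funext => b; rewrite (mul_seriesC Dq q f).
  rewrite /mpoly_mul_series mul1r mulN1r -sumrB; apply: eq_bigr => m _.
  by rewrite -mulrBr; congr (_ * _); rewrite mul0r addr0; exact: leibniz.
apply: trivial_series_lin; apply: trivial_series_mul => //.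
exact: (trivial_series_lin _ (fun=> 0)).
Qed.

(** Scaling by c^(a_i) is the substitution z_i -> c z_i, which may also be
    applied to the denominator. *)
Lemma admissible_exp fin i (c : C) : c != 0 ->
  admissible fin (fun a => c ^ a 0 i).
Proof.
move=> c0 f [q q0 [s [fs f0]]].
pose qc : mpoly n C := \sum_(m <- msupp q) (c ^+ m i * mcoeff m q) *: mpolyX C m.
have coefE m : mcoeff m qc = c ^+ m i * mcoeff m q.
  rewrite /qc raddf_sum /=; under eq_bigr do rewrite mcoeffZ mcoeffX.
  have [mq|/memN_msupp_eq0 m0] := boolP (m \in msupp q).
    rewrite (bigD1_seq m) ?msupp_uniq //= eqxx mulr1 big1 ?addr0 // => k km.
    by rewrite (negbTE km) mulr0.
  by rewrite m0 mulr0 big1 // => k _; case: eqP => [->|]; rewrite ?m0 ?mulr0 ?mul0r.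
exists qc.
  apply: contra_neq q0 => qc0; apply/mpolyP => m; rewrite mcoeff0.
  have /eqP := coefE m; rewrite qc0 mcoeff0 eq_sym mulf_eq0 expf_eq0 (negbTE c0).
  by rewrite andbF => /eqP.
exists s; split=> // b /f0 bs; rewrite mul_series_monomials.
transitivity (c ^ b 0 i * mpoly_mul_series q f b); last by rewrite bs mulr0.
rewrite /mpoly_mul_series mulr_sumr; apply: eq_bigr => m _.
have -> : c ^ b 0 i = c ^+ m i * c ^ (b - int_expo m) 0 i.
  by rewrite !mxE exprnP -expfzDr // addrCA subrr addr0.
by ring.
Qed.

Lemma admissible_exp_poly fin (k : 'I_n -> nat)
    (p : forall i, 'I_(k i) -> {poly C}) (g : forall i, 'I_(k i) -> C) :
  (forall i j, g i j != 0) -> admissible fin (exp_poly_weight p g).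
Proof.
move=> g0; apply: admissible_prod => i; apply: admissible_sum => j.
apply: admissibleM; last exact: admissible_exp.
under eq_fun do rewrite horner_coef.
apply: admissible_sum => l; apply: admissibleM; first exact: admissible_cst.
exact/admissibleX/admissible_coord.
Qed.

Lemma exp_poly_weightN (k : 'I_n -> nat)
    (p : forall i, 'I_(k i) -> {poly C}) (g : forall i, 'I_(k i) -> C) a :
  exp_poly_weight p g (- a) =
  exp_poly_weight (fun i j => p i j \Po (- 'X)) (fun i j => (g i j)^-1) a.
Proof.
apply: eq_bigr => i _; apply: eq_bigr => j _.
by rewrite !mxE horner_comp hornerN hornerX rmorphN /= exprz_inv.
Qed.

(** A finitely supported series becomes polynomial after a shift by a large
    monomial, which goes into the denominator. *)
Lemma is_rational_quasi_trivial f : quasi_trivial true f -> is_rational f.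
Proof.
move=> [q q0 [s [_ f0]]].
pose B := \max_(a <- s) \max_(i < n) absz (a 0%R i).
pose M : multinom n := Multinom [tuple B | i < n].
pose e a := pos_expo (a + int_expo M).
pose g := mpoly_mul_series q f.
pose p : mpoly n C := \sum_(a <- undup s) g a *: mpolyX C (e a).
have eE a : a \in s -> int_expo (e a) = a + int_expo M.
  move=> sa; apply/rowP => i; rewrite !mxE !mnmE !mxE !mnmE.
  suff : (absz (a 0%R i) <= B)%N by case: ifP; move: {+}(a 0 i) {+}B => x y; lia.
  apply: bigmaxn_sup_seq sa _ _ => //.
  exact: (leq_bigmax i).
exists ((FracField.tofrac p) / FracField.tofrac (mpolyX C M * q)), p, (mpolyX C M * q).
split=> //.
  by rewrite mulf_neq0 // -msupp_eq0 msuppX.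
apply/funext => b; rewrite series_of_mpolyE mul_series_monomials mul_seriesA.
rewrite -[mpolyX C M]scale1r mul_seriesZX mul1r -/g.
symmetry; transitivity (\sum_(a <- undup s) g a * (a == b - int_expo M)%:R).
  rewrite big_seq [RHS]big_seq; apply: eq_bigr => a; rewrite mem_undup => sa.
  by rewrite eE // subr_eq0 -subr_eq eq_sym.
have [bs|bs] := boolP (b - int_expo M \in s).
  rewrite (bigD1_seq (b - int_expo M)) ?mem_undup ?undup_uniq //= eqxx mulr1.
  by rewrite big1 ?addr0 // => a /negbTE ->; rewrite mulr0.
rewrite big_seq big1 => [|a]; first exact/esym/f0.
by rewrite mem_undup; case: eqP => [-> |]; rewrite ?mulr0 // (negbTE bs).
Qed.

End SeriesModule.

(** * Regions of a central hyperplane arrangement *)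

Lemma int_box n (B : nat) : exists s : seq 'rV[int]_n,
  forall a : 'rV[int]_n, (forall j, absz (a 0%R j) <= B)%N -> a \in s.
Proof.
exists [seq \row_j ((f j : nat)%:Z - B%:Z) | f : {ffun 'I_n -> 'I_(B + B).+1}].
move=> a aB; apply/mapP.
exists [ffun j => inord (absz (a 0%R j + B%:Z))]; first by rewrite mem_enum.
apply/rowP => j; rewrite mxE ffunE inordK; have := aB j.
  by move: (a 0 j) => x; lia.
by move: (a 0 j) => x; lia.
Qed.

Lemma left_kernel_int n m (L : 'M[int]_(n, m)) :
  (\rank (map_mx intr L : 'M[rat]_(n, m)) < n)%N ->
  exists2 u : 'rV[int]_n, u != 0 & u *m L = 0.
Proof.
set A := map_mx _ _ => rkA.
have K0 : kermx A != 0 by rewrite -mxrank_eq0 mxrank_ker subn_eq0 -ltnNge.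
pose v := nz_row (kermx A).
have v0 : v != 0 by rewrite nz_row_eq0.
have vA : v *m A = 0 by apply/sub_kermxP; exact: nz_row_sub.
pose D : int := \prod_i denq (v 0 i).
pose u : 'rV[int]_n := \row_i (numq (v 0 i) * \prod_(k | k != i) denq (v 0 k)).
have uE : map_mx intr u = (D%:~R : rat) *: v.
  apply/rowP => i; rewrite !mxE.
  have -> : D = denq (v 0 i) * \prod_(k | k != i) denq (v 0 k) by rewrite /D (bigD1 i).
  by rewrite !intrM mulrAC -[in RHS](mulrC (v 0 i)) numqE.
have D0 : (D%:~R : rat) != 0.
  by rewrite intr_eq0; apply/prodf_neq0 => i _; exact: denq_neq0.
have injz : injective (intr : int -> rat) by exact: intr_inj.
exists u.
  apply: contra_neq v0 => u0; apply/eqP; move/eqP: uE.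
  by rewrite u0 map_mx0 eq_sym scaler_eq0 (negbTE D0).
have : map_mx intr (u *m L) = 0 :> 'rV[rat]_m.
  by rewrite map_mxM uE -scalemxAl -/A vA scaler0.
by move=> /rowP uL; apply/rowP => j; apply: injz; have := uL j; rewrite !mxE.
Qed.

(** The case distinction of the inductions on the number of hyperplanes, which
    are the columns of L: a relation between them, a line in all of them, or a
    simplicial arrangement.  The first two provide integer vectors because a
    rational kernel vector can be cleared of denominators. *)
Lemma column_relation n m (L : 'M[int]_(n, m)) :
  [\/ exists2 c : 'cV[int]_m, c != 0 & L *m c = 0,
      exists2 u : 'rV[int]_n, u != 0 & u *m L = 0
    | exists e : m = n, \det (castmx (erefl, e) L) != 0].
Proof.
have [rn|rn] := ltnP (\rank (map_mx intr L : 'M[rat]_(n, m))) n.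
  by apply: Or32; exact: left_kernel_int.
have [rm|rm] := ltnP (\rank (map_mx intr L : 'M[rat]_(n, m))) m.
  apply: Or31; have [|u u0 uL] := left_kernel_int (L := L^T).
    by rewrite -map_trmx mxrank_tr.
  exists u^T; first by rewrite -(inj_eq trmx_inj) trmxK trmx0.
  by apply: trmx_inj; rewrite trmx_mul trmxK uL trmx0.
apply: Or33.
have e : m = n.
  apply/eqP; rewrite eqn_leq (leq_trans rm (rank_leq_row _)).
  exact: leq_trans rn (rank_leq_col _).
exists e; case: _ / e L rn rm => L rn _; rewrite castmx_id.
have : (map_mx intr L : 'M[rat]_m) \in unitmx by rewrite -row_free_unit -row_leq_rank.
by rewrite unitmxE det_map_mx unitfE intr_eq0.
Qed.

Section Regions.
Variables (C : fieldType) (n : nat).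

Definition flip m (j : 'I_m) (sg : 'I_m -> bool) : 'I_m -> bool :=
  fun i => (i == j) (+) sg i.

(** If crossing any hyperplane changes E into -E modulo the module, then the
    value of E at one sign vector determines all the others. *)
Lemma flip_walk fin m (E : ('I_m -> bool) -> formal_series C n) :
  (forall sg j, quasi_trivial fin (fun a => E sg a + E (flip j sg) a)) ->
  forall sg tau, quasi_trivial fin
    (fun a => E sg a - (-1) ^+ #|[pred j | sg j != tau j]| * E tau a).
Proof.
move=> step sg tau; move ek: #|_| => k; elim: k sg ek => [|k IH] sg ek.
  have -> : sg = tau.
    apply/funext => j; have := card0_eq ek j.
    by rewrite inE => /negbT; rewrite negbK => /eqP.
  by under eq_fun do rewrite expr0 mul1r subrr; exact: quasi_trivial0.
have /card_gt0P[j] : (0 < #|[pred j | sg j != tau j]|)%N by rewrite ek.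
rewrite inE => dj.
have ek' : #|[pred i | flip j sg i != tau i]| = k.
  apply/eqP; rewrite -eqSS -ek (cardD1 j [pred i | sg i != tau i]) inE dj add1n eqSS.
  apply/eqP/eq_card => i; rewrite !inE /flip.
  by have [->|] := eqVneq i j => //=; move: dj; case: (sg j); case: (tau j).
have := quasi_trivial_lin (-1) (IH _ ek') (step sg j).
by congr quasi_trivial; apply/funext => a; rewrite exprS; ring.
Qed.

Definition region m (L : 'M[int]_(n, m)) (sg : 'I_m -> bool) : formal_series C n :=
  fun a => [forall j, (0 <= (a *m L) 0 j) == sg j]%:R.

(** Forgetting the hyperplane j merges the two regions that it separates; regions
    are half-open, closed on the positive side, so that no point is lost or
    counted twice. *)
Lemma region_flip m (L : 'M[int]_(n, m.+1)) (j : 'I_m.+1) sg a :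
  region L sg a + region L (flip j sg) a =
  region (col' j L) (fun i => sg (lift j i)) a.
Proof.
have splitE (b : pred 'I_m.+1) : [forall i, b i] = b j && [forall i, b (lift j i)].
  apply/forallP/andP => [bb|[bj /forallP bb] i]; first by split=> //; apply/forallP.
  by case: (unliftP j i) => [k ->|->].
have flipj : flip j sg j = ~~ sg j by rewrite /flip eqxx.
rewrite /region !splitE flipj.
have liftE i : (a *m L) 0 (lift j i) = (a *m col' j L) 0 i.
  by rewrite !mxE; apply: eq_bigr => k _; rewrite mxE.
have -> : [forall i, (0 <= (a *m L) 0 (lift j i)) == sg (lift j i)] =
    [forall i, (0 <= (a *m col' j L) 0 i) == sg (lift j i)].
  by apply: eq_forallb => i; rewrite liftE.
have -> : [forall i, (0 <= (a *m L) 0 (lift j i)) == flip j sg (lift j i)] =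
    [forall i, (0 <= (a *m col' j L) 0 i) == sg (lift j i)].
  by apply: eq_forallb => i; rewrite liftE /flip [lift j i == j]eq_sym (negbTE (neq_lift _ _)).
by case: (_ <= _); case: (sg j); rewrite /= ?add0r ?addr0.
Qed.

(** The translation by u preserves the region, hence 1 - z^u annihilates it. *)
Lemma quasi_trivial_region_line fin m (L : 'M[int]_(n, m)) (u : 'rV[int]_n) sg :
  u != 0 -> u *m L = 0 -> quasi_trivial fin (region L sg).
Proof.
move=> u0 uL; apply: (quasi_trivial_diff u0).
rewrite (_ : (fun=> _) = fun=> 0); first exact: quasi_trivial0.
by apply/funext => a; rewrite /region mulmxBl uL subr0 subrr.
Qed.

(** The signs of a linear relation between the columns are those of a system
    without solution: the relation would be a sum of nonnegative terms, and a
    strict inequality in the system makes one of them positive. *)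
Lemma region_relation0 m (L : 'M[int]_(n, m)) (c : 'cV[int]_m) sg a j :
  L *m c = 0 -> (forall i, if sg i then 0 <= c i 0 else c i 0 <= 0) ->
  ~~ sg j -> c j 0 < 0 -> region L sg a = 0.
Proof.
move=> Lc csg sj cj; rewrite /region; case: forallP => // y.
have : a *m L *m c = 0 by rewrite -mulmxA Lc mulmx0.
move=> /matrixP/(_ 0 0); rewrite !mxE => s0.
have term i : 0 <= (a *m L) 0 i * c i 0.
  have := csg i; have /eqP := y i; case: (sg i) => yi ci; first exact: mulr_ge0.
  by apply: mulr_le0 => //; apply: ltW; rewrite ltNge yi.
have /eqP := y j; rewrite (negbTE sj) => /negbT; rewrite -ltNge => yj.
have := psumr_eq0P (fun i _ => term i) s0 (i := j) isT => /eqP.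
by rewrite mulf_eq0 (lt_eqF yj) (lt_eqF cj).
Qed.

(** In the coordinates given by the columns of L the region is a product of
    functions of one variable.  A row v of the adjugate of L moves one coordinate
    alone, by d = det L, so 1 - z^v replaces one factor by its d-difference; once
    all the factors are differences, the support is finite. *)
Lemma quasi_trivial_simplicial m (e : m = n) (L : 'M[int]_(n, m)) sg :
  \det (castmx (erefl, e) L) != 0 ->
  quasi_trivial true (region L sg).
Proof.
subst m; rewrite castmx_id => d0; set d := \det L in d0.
pose chi j (t : int) : C := ((0 <= t) == sg j)%:R.
pose F (ch : 'I_n -> int -> C) : formal_series C n :=
  fun a => \prod_j ch j ((a *m L) 0 j).
pose delta j t := chi j t - chi j (t - d).
have -> : region L sg = F chi.
  apply/funext => a; rewrite /region /F /chi -natr_prod; congr _%:R.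
  case: forallP => [y|ny]; first by rewrite big1 // => j _; rewrite y.
  suff [j /negbTE nj] : exists j, ~~ ((0 <= (a *m L) 0 j) == sg j).
    by rewrite (bigD1 j) //= nj mul0n.
  by apply/existsP; rewrite -negb_forall; apply/forallP.
suff mixed (s : seq 'I_n) :
    quasi_trivial true (F (fun j => if j \in s then chi j else delta j)).
  have := mixed (enum 'I_n); congr quasi_trivial; apply/funext => a.
  by apply: eq_bigr => j _; rewrite mem_enum.
elim: s => [|j s IH].
  apply: quasi_trivial_of_trivial.
  have [box boxP] := int_box n `|d|%N.
  exists [seq map_mx (divz^~ d) (y *m \adj L) | y <- box]; split; first by left.
  move=> a aN; have [j dj] : exists j, (`|d| < absz ((a *m L) 0%R j))%N.
    apply/existsP; apply: contraR aN; rewrite negb_exists => /forallP small.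
    apply/mapP; exists (a *m L); first by apply: boxP => j; rewrite leqNgt small.
    apply/rowP => j; rewrite mxE -mulmxA mul_mx_adj mul_mx_scalar mxE.
    by rewrite mulrC mulzK.
  rewrite /F (bigD1 j) //= /delta /chi.
  suff -> : (0 <= (a *m L) 0 j - d) = (0 <= (a *m L) 0 j) by rewrite subrr mul0r.
  by move: ((a *m L) 0 j) dj => y; clearbody d; lia.
have [js|js] := boolP (j \in s).
  suff -> : (fun i => if i \in j :: s then chi i else delta i) =
            (fun i => if i \in s then chi i else delta i) by [].
  by apply/funext => i; rewrite inE; case: eqP => [->|]; rewrite ?js.
pose v := row j (\adj L).
have vL i : (v *m L) 0 i = d * (i == j)%:R.
  by rewrite -row_mul mul_adj_mx !mxE eq_sym mulr_natr.
apply: (@quasi_trivial_diff _ _ _ _ v).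
  apply: contra_neq d0 => v0; have := vL j.
  by rewrite v0 mul0mx mxE eqxx mulr1.
move: IH; congr quasi_trivial; apply/funext => a.
have subE b i : ((a - b%:R *: v) *m L) 0 i = (a *m L) 0 i - d * b%:R * (i == j)%:R.
  rewrite mulmxBl -scalemxAl [LHS]mxE [X in _ + X]mxE [X in _ - X]mxE vL.
  by rewrite mulrA (mulrC d).
have FE b : F (fun i => if i \in j :: s then chi i else delta i) (a - b%:R *: v) =
   chi j ((a *m L) 0 j - d * b%:R) *
   \prod_(i | i != j) (if i \in s then chi i else delta i) ((a *m L) 0 i).
  rewrite /F (bigD1 j) //= inE eqxx /= subE eqxx mulr1; congr (_ * _).
  by apply: eq_bigr => i ij; rewrite inE subE (negbTE ij) /= mulr0 subr0.
have := FE 0%N; have := FE 1%N; rewrite scale1r scale0r subr0 mulr0 mulr1 subr0 => -> ->.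
by rewrite /F (bigD1 j) //= (negbTE js) -mulrBl.
Qed.

Lemma exists_signed_entry m (c : 'cV[int]_m) : c != 0 ->
  exists j, c j 0 < 0 \/ 0 < c j 0.
Proof.
move=> c0; have [j cj] : exists j, c j 0 != 0.
  apply/existsP; apply: contraR c0; rewrite negb_exists => /forallP c0.
  by apply/eqP/colP => j; rewrite mxE; apply/eqP; rewrite -[_ == _]negbK c0.
by exists j; apply/orP; rewrite -neq_lt.
Qed.

(** By induction, the regions of the arrangement without one hyperplane are
    rational, so modulo rational series crossing a hyperplane changes the sign of
    a region; a relation between the hyperplanes gives an empty region to which
    every other one can be brought. *)
Lemma region_rational m (L : 'M[int]_(n, m)) sg : quasi_trivial true (region L sg).
Proof.
elim: m L sg => [|m IH] L sg.
all: have [[c c0 Lc]|[u u0 uL]|[e de]] := column_relation L.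
all: try exact: quasi_trivial_region_line u0 uL.
all: try exact: (quasi_trivial_simplicial (e := e)).
  by rewrite flatmx0 eqxx in c0.
wlog [j cj] : c c0 Lc / exists j, c j 0 < 0.
  move=> wl; have [j [cj|cj]] := exists_signed_entry c0; first by apply: (wl c) => //; exists j.
  apply: (wl (- c)); rewrite ?oppr_eq0 ?mulmxN ?Lc ?oppr0 //.
  by exists j; rewrite mxE oppr_lt0.
pose tau i := 0 <= c i 0.
have tau0 a : region L tau a = 0.
  apply: (region_relation0 (j := j) a Lc) => //; last by rewrite /tau -ltNge.
  by move=> i; rewrite /tau; case: lerP => // /ltW.
have step sg' i : quasi_trivial true (fun a => region L sg' a + region L (flip i sg') a).
  by under eq_fun do rewrite region_flip; exact: IH.
have := flip_walk step sg tau.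
by under eq_fun do rewrite tau0 mulr0 subr0.
Qed.

(** The difference E of a region and of its signed opposite is additive in the
    same way as the region, so it can be transported across the hyperplanes too.
    Since w lies on the positive side of all of them, a relation between them has
    coefficients of both signs, so that the region of its signs and the opposite
    region are both empty, and E vanishes there.  In a simplicial arrangement the
    regions themselves can be transported, because fewer than n hyperplanes
    have a line in common, and the opposite region is n crossings away. *)
Lemma region_reciprocity (R : realFieldType) m (L : 'M[int]_(n, m)) (w : 'rV[R]_n) sg :
  (forall j, 0 < (w *m map_mx intr L) 0 j) ->
  quasi_trivial false
    (fun a => region L sg a - (-1) ^+ n * region L (fun j => ~~ sg j) a).
Proof.
elim: m L sg => [|m IH] L sg w0.
all: have [[c c0 Lc]|[u u0 uL]|[e _]] := column_relation L.
- by rewrite flatmx0 eqxx in c0.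
- have qt sg' := quasi_trivial_region_line false sg' u0 uL.
  have := quasi_trivial_lin (- (-1) ^+ n) (qt (fun j => ~~ sg j)) (qt sg).
  by under eq_fun do rewrite addrC mulNr.
(* Without hyperplanes the simplicial case is that of dimension 0. *)
- have -> : (fun j => ~~ sg j) = sg by apply/funext => -[].
  have -> : (-1) ^+ n = 1 :> C by rewrite -e.
  by under eq_fun do rewrite mul1r subrr; exact: quasi_trivial0.
- have neg (d : 'cV[int]_m.+1) : d != 0 -> L *m d = 0 -> exists j, d j 0 < 0.
    move=> d0 Ld; apply/existsP; apply: contraR d0; rewrite negb_exists => /forallP dp.
    have : w *m map_mx intr L *m map_mx intr d = 0.
      by rewrite -mulmxA -map_mxM Ld map_mx0 mulmx0.
    move=> /matrixP/(_ 0 0); rewrite [LHS]mxE [RHS]mxE => s0.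
    apply/eqP/colP => j; rewrite mxE.
    have term i : 0 <= (w *m map_mx intr L) 0 i * (map_mx intr d : 'cV[R]_m.+1) i 0.
      by apply: mulr_ge0; [exact: ltW|rewrite mxE ler0z leNgt dp].
    have /eqP := psumr_eq0P (fun i _ => term i) s0 (i := j) isT.
    by rewrite mulf_eq0 gt_eqF //= mxE intr_eq0 => /eqP.
  have [j cj] := neg _ c0 Lc.
  have [|| k] := neg (- c); rewrite ?oppr_eq0 ?mulmxN ?Lc ?oppr0 // mxE oppr_lt0 => ck.
  pose tau i := 0 <= c i 0.
  pose E sg' a : C := region L sg' a - (-1) ^+ n * region L (fun j => ~~ sg' j) a.
  have tau0 a : E tau a = 0.
    rewrite /E (region_relation0 (j := j) a Lc) //; last by rewrite /tau -ltNge.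
      rewrite (@region_relation0 _ L (- c) _ a k) ?mulmxN ?Lc ?oppr0 ?mulr0 ?subrr //.
      + move=> i; rewrite /tau mxE; case: (lerP 0 (c i 0)) => /= ci.
          by rewrite oppr_le0.
        by rewrite oppr_ge0 ltW.
      + by rewrite negbK /tau ltW.
      + by rewrite mxE oppr_lt0.
    by move=> i; rewrite /tau; case: lerP => // /ltW.
  have step sg' i : quasi_trivial false (fun a => E sg' a + E (flip i sg') a).
    have w0' l : 0 < (w *m map_mx intr (col' i L)) 0 l.
      have := w0 (lift i l); rewrite !mxE; congr (0 < _).
      by apply: eq_bigr => b _; rewrite !mxE.
    have := IH (col' i L) (fun l => sg' (lift i l)) w0'.
    congr quasi_trivial; apply/funext => a; rewrite -region_flip.
    rewrite -(region_flip L i (fun l => ~~ sg' l)) /E.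
    have -> : flip i (fun l => ~~ sg' l) = (fun l => ~~ flip i sg' l).
      by apply/funext => l; rewrite /flip addbN.
    by ring.
  have := flip_walk step sg tau.
  by under eq_fun do rewrite tau0 mulr0 subr0.
- have qt sg' := quasi_trivial_region_line false sg' u0 uL.
  have := quasi_trivial_lin (- (-1) ^+ n) (qt (fun j => ~~ sg j)) (qt sg).
  by under eq_fun do rewrite addrC mulNr.
have step sg' j : quasi_trivial false (fun a => region L sg' a + region L (flip j sg') a).
  under eq_fun do rewrite region_flip.
  have [|u u0 uL] := left_kernel_int (L := col' j L).
    by rewrite (leq_ltn_trans (rank_leq_col _)) // -e.
  exact: quasi_trivial_region_line u0 uL.
have := flip_walk step sg (fun j => ~~ sg j).
suff -> : #|[pred j | sg j != ~~ sg j]| = n by [].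
by rewrite -[RHS]e -[RHS]card_ord; apply: eq_card => j; rewrite !inE; case: (sg j).
Qed.

End Regions.

(** * Rational cones as intersections of half-spaces *)

Section RationalCones.
Variables (R : realType) (n : nat).
Implicit Types (l : 'cV[int]_n) (ls : seq 'cV[int]_n) (x y : 'rV[R]_n).

Definition pairing l x : R := (x *m map_mx intr l) 0 0.

Lemma pairingD l x y : pairing l (x + y) = pairing l x + pairing l y.
Proof. by rewrite /pairing mulmxDl mxE. Qed.

Lemma pairingZ l (t : R) x : pairing l (t *: x) = t * pairing l x.
Proof. by rewrite /pairing -scalemxAl mxE. Qed.

Lemma pairingB l x y : pairing l (x - y) = pairing l x - pairing l y.
Proof. by rewrite -scaleN1r pairingD pairingZ mulN1r. Qed.

Lemma pairing_sum l (m : nat) (x : 'I_m -> 'rV[R]_n) :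
  pairing l (\sum_i x i) = \sum_i pairing l (x i).
Proof. by rewrite /pairing mulmx_suml summxE. Qed.

Lemma pairing_comb (c d : int) l l' x :
  pairing (c *: l - d *: l') x = c%:~R * pairing l x - d%:~R * pairing l' x.
Proof.
rewrite /pairing !mxE !mulr_sumr -sumrB; apply: eq_bigr => i _.
by rewrite !mxE rmorphB /= !intrM; ring.
Qed.

Definition polyhedral_cone ls : set 'rV[R]_n :=
  [set x | forall l, l \in ls -> 0 <= pairing l x].

Definition ray_sum (u : 'rV[R]_n) (K : set 'rV[R]_n) : set 'rV[R]_n :=
  [set x | exists2 t : R, 0 <= t & K (x - t *: u)].

(** Fourier-Motzkin elimination of the multiplier t of u: each inequality bounds
    t from above or from below according to the sign of its value at u, and a
    suitable t exists when every lower bound, 0 included, is at most every upper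
    bound. *)
Lemma ray_sum_polyhedral ls (u : 'rV[int]_n) :
  exists ls', ray_sum (int_point R u) (polyhedral_cone ls) = polyhedral_cone ls'.
Proof.
pose e l : int := (u *m l) 0 0.
have eE l : pairing l (int_point R u) = (e l)%:~R.
  by rewrite /pairing /int_point -map_mxM mxE.
pose combs := [seq e p.1 *: p.2 - e p.2 *: p.1 |
  p <- [seq (l, l') | l <- [seq l <- ls | 0 < e l], l' <- [seq l <- ls | e l < 0]]].
exists ([seq l <- ls | 0 <= e l] ++ combs); apply/seteqP; split=> x.
  move=> [t t0 Kx] l; rewrite mem_cat => /orP[|].
    rewrite mem_filter => /andP[el ll]; have := Kx _ ll.
    rewrite pairingB pairingZ eE => h; rewrite -[pairing l x](subrK (t * (e l)%:~R)).
    by apply: addr_ge0 => //; apply: mulr_ge0; rewrite ?ler0z.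
  move=> /mapP[_ /allpairsP[[a b] /= [+ + ->]] ->] /=.
  rewrite !mem_filter => /andP[ea la] /andP[eb lb].
  have := Kx _ la; have := Kx _ lb; rewrite pairing_comb !pairingB !pairingZ !eE.
  move: ea eb; rewrite -(ltr0z R) -(ltrz0 R).
  move: (pairing a x) (pairing b x) (_%:~R) (_%:~R) => pa pb ea eb; nra.
move=> Kx.
pose t : R := \big[Num.max/0]_(l <- ls | e l < 0) (pairing l x / (e l)%:~R).
have t0 : 0 <= t by exact: bigmax_ge_id.
exists t => // l ll; rewrite pairingB pairingZ eE subr_ge0.
have [el|el|el] := ltgtP (e l) 0; last first.
- by rewrite el mulr0; apply: Kx; rewrite mem_cat mem_filter el lexx ll.
- rewrite -ler_pdivlMr ?ltr0z // /t big_seq_cond; apply: bigmax_le => [|b /andP[lb eb]].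
    have h : 0 <= pairing l x by apply: Kx; rewrite mem_cat mem_filter ltW // ll.
    by rewrite divr_ge0 // ler0z ltW.
  have : 0 <= pairing (e l *: b - e b *: l) x.
    apply: Kx; rewrite mem_cat; apply/orP; right; apply/mapP; exists (l, b) => //.
    by apply/allpairsP; exists (l, b); rewrite !mem_filter el eb ll lb.
  rewrite pairing_comb ler_pdivlMr ?ltr0z // mulrAC ler_ndivrMr ?ltrz0 //.
  by rewrite subr_ge0 (mulrC _%:~R (pairing l x)) (mulrC _%:~R (pairing b x)).
- rewrite -ler_ndivrMr ?ltrz0 //.
  exact: (le_bigmax_seq _ l).
Qed.

Definition ray_sums (us : seq 'rV[int]_n) : set 'rV[R]_n :=
  foldr (fun u => ray_sum (int_point R u)) [set 0] us.

Lemma ray_sums_polyhedral us :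
  exists2 ls, 0 \notin ls & ray_sums us = polyhedral_cone ls.
Proof.
suff [ls ->] : exists ls, ray_sums us = polyhedral_cone ls.
  exists [seq l <- ls | l != 0]; first by rewrite mem_filter eqxx.
  apply/seteqP; split=> x Kx l; first by rewrite mem_filter => /andP[_ /Kx].
  have [-> _|l0 ll] := eqVneq l 0; last by apply: Kx; rewrite mem_filter l0.
  by rewrite /pairing map_mx0 mulmx0 mxE.
elim: us => [|u us [ls IH]]; last first.
  by rewrite /= IH; exact: ray_sum_polyhedral.
exists ([seq delta_mx i 0 | i : 'I_n] ++ [seq - delta_mx i 0 | i : 'I_n]).
have coordE x (i : 'I_n) : pairing (delta_mx i 0) x = x 0 i.
  rewrite /pairing mxE (bigD1 i) //= big1 ?addr0 => [|k ki].
    by rewrite !mxE !eqxx mulr1.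
  by rewrite !mxE (negbTE ki) mulr0.
have coordNE x (i : 'I_n) : pairing (- delta_mx i 0) x = - x 0 i.
  by rewrite -coordE /pairing map_mxN mulmxN mxE.
apply/seteqP; split=> x /=.
  move=> -> l; rewrite mem_cat => /orP[] /mapP[i _ ->].
    by rewrite coordE mxE.
  by rewrite coordNE mxE oppr0.
move=> Kx; apply/rowP => i; rewrite mxE; apply/eqP; rewrite eq_le -oppr_ge0.
rewrite -coordNE -[X in _ && (_ <= X)]coordE.
apply/andP; split; apply: Kx; rewrite mem_cat; apply/orP; [right|left].
  by apply/mapP; exists i; rewrite ?mem_enum.
by apply/mapP; exists i; rewrite ?mem_enum.
Qed.

(** Rays are added one at a time, while a conic combination may repeat them: that
    the ray sum contains every conic combination is read off its half-spaces. *)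
Lemma conic_hull_ray_sums (S : set 'rV[R]_n) us :
  (forall x, S x <-> exists2 u, u \in us & x = int_point R u) ->
  conic_hull S = ray_sums us.
Proof.
move=> SE; have [ls _ usE] := ray_sums_polyhedral us.
have conic_incl : ray_sums us `<=` conic_hull S.
  have: {subset us <= us} by [].
  elim: {1 3}us => [_ x ->|u vs IH sub x [t t0 /=]].
    by exists 0%N, (fun=> 0), (fun=> 0); split=> //; [case|rewrite big_ord0].
  move=> /IH[|m [c [y [c0 Sy xE]]]]; first by move=> v vv; rewrite sub // inE vv orbT.
  exists m.+1, (fun i => oapp c t (unlift ord0 i)).
  exists (fun i => oapp y (int_point R u) (unlift ord0 i)); split.
  - by move=> i; case: unlift.
  - move=> i; case: unlift => //=; apply/SE; exists u => //.
    by rewrite sub // inE eqxx.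
  rewrite big_ord_recl unlift_none /=; under eq_bigr do rewrite liftK /=.
  by rewrite -xE addrC subrK.
apply/seteqP; split=> // x [m [c [y [c0 Sy ->]]]].
rewrite usE => l ll; rewrite pairing_sum; apply: sumr_ge0 => i _.
rewrite pairingZ; apply: mulr_ge0 => //.
have /SE[u uu ->] := Sy i.
suff : ray_sums us (int_point R u) by rewrite usE; apply.
elim: us uu {SE usE conic_incl} => // v vs IH.
have zero (ws : seq 'rV[int]_n) : ray_sums ws 0.
  by elim: ws => //= w ws h; exists 0; rewrite // scale0r subrr.
rewrite inE => /predU1P[->|/IH h]; first by exists 1; rewrite // scale1r subrr.
by exists 0; rewrite // scale0r subr0.
Qed.

(** At a point where an inequality is tight, a small step against its normal
    vector, which is nonzero, leaves the cone. *)
Lemma interior_polyhedral_cone ls : 0 \notin ls ->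
  interior (polyhedral_cone ls) =
  [set x | forall l, l \in ls -> 0 < pairing l x].
Proof.
move=> ls0; apply/seteqP; split=> x.
  move=> /nbhs_ballP[e /= e0 sub] l ll.
  have l0 : l != 0 by apply: contraNneq ls0 => <-.
  pose M : R := \sum_i `|(l i 0)%:~R|.
  (* The 1 makes N positive and larger than each coordinate of the normal. *)
  pose N : R := 1 + \sum_i `|(l i 0)%:~R : R|.
  have N0 : 0 < N by rewrite ltr_pwDl // sumr_ge0.
  pose c : R := e / N; have c0 : 0 < c by exact: divr_gt0.
  pose nu : 'rV[R]_n := map_mx intr l^T.
  have nu0 : 0 < pairing l nu.
    rewrite /pairing mxE; under eq_bigr do rewrite !mxE.
    have sq i : 0 <= (l i 0)%:~R * (l i 0)%:~R :> R by rewrite -expr2 sqr_ge0.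
    rewrite lt_def sumr_ge0 // andbT; apply: contra l0 => /eqP s0.
    apply/eqP/colP => i; have /eqP := psumr_eq0P (fun i _ => sq i) s0 (i := i) isT.
    by rewrite mulf_eq0 orbb intr_eq0 mxE => /eqP.
  have : polyhedral_cone ls (x - c *: nu).
    apply: sub; split=> // i j; rewrite /ball /= !mxE (ord1 i) opprB addrC subrK.
    rewrite normrM gtr0_norm // /c mulrAC ltr_pdivrMr // ltr_pM2l //.
    rewrite /N (bigD1 j) //= addrCA ltrDl ltr_pwDl // sumr_ge0 //.
  move=> /(_ l ll); rewrite pairingB pairingZ subr_ge0; apply: lt_le_trans.
  exact: mulr_gt0.
move=> /= xl; rewrite /interior /=.
elim: ls {ls0} xl => [|l ls IH] xl; first by apply: filterS filterT => y _ l.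
have lx : 0 < pairing l x by apply: xl; rewrite inE eqxx.
have {}IH : nbhs x (polyhedral_cone ls).
  by apply: IH => k kk; apply: xl; rewrite inE kk orbT.
suff lnear : nbhs x [set y | 0 <= pairing l y].
  apply: filterS2 lnear IH => y ly lsy k; rewrite inE => /predU1P[->//|]; exact: lsy.
pose N : R := 1 + \sum_i `|(l i 0)%:~R : R|.
have N0 : 0 < N by rewrite ltr_pwDl // sumr_ge0.
apply/nbhs_ballP; exists (pairing l x / N) => /=; first exact: divr_gt0.
move=> y [_ xy] /=; rewrite -[y](subKr x) pairingB subr_ge0.
apply: le_trans (ler_norm _) _; rewrite /pairing mxE.
apply: le_trans (ler_norm_sum _ _ _) _.
apply: (@le_trans _ _ (\sum_i pairing l x / N * `|(l i 0)%:~R : R|)).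
  apply: ler_sum => i _; rewrite !mxE normrM; apply: ler_wpM2r => //.
  exact/ltW/(xy 0 i).
rewrite -mulr_sumr mulrAC ler_pdivrMr // ler_wpM2l ?ltW //.
by rewrite /N ltrDr.
Qed.

Lemma conic_hull_matrix (S : set 'rV[R]_n) (us : seq 'rV[int]_n) :
  (forall x, S x <-> exists2 u, u \in us & x = int_point R u) ->
  exists (m : nat) (L : 'M[int]_(n, m)),
    conic_hull S = [set x | forall j, 0 <= (x *m map_mx intr L) 0 j] /\
    interior (conic_hull S) = [set x | forall j, 0 < (x *m map_mx intr L) 0 j].
Proof.
move=> SE; rewrite (conic_hull_ray_sums SE).
have [ls ls0 ->] := ray_sums_polyhedral us.
exists (size ls), (\matrix_(i, j) (ls`_j) i 0).
have LE x (j : 'I_(size ls)) :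
    (x *m map_mx intr (\matrix_(i, j) (ls`_j) i 0)) 0 j = pairing ls`_j x.
  by rewrite /pairing !mxE; apply: eq_bigr => i _; rewrite !mxE.
rewrite (interior_polyhedral_cone ls0); split; apply/seteqP; split=> x /= h.
- by move=> j; rewrite LE; apply: h; exact: mem_nth.
- by move=> l /(nthP 0)[j jl <-]; have := h (Ordinal jl); rewrite LE.
- by move=> j; rewrite LE; apply: h; exact: mem_nth.
- by move=> l /(nthP 0)[j jl <-]; have := h (Ordinal jl); rewrite LE.
Qed.

(** The coordinates of a point of P are bounded by the sum of those of the
    vertices, in absolute value. *)
Lemma rational_polytope_int_points (P : set 'rV[R]_n) : rational_polytope P ->
  exists us : seq 'rV[int]_n, forall a, P (int_point R a) <-> a \in us.
Proof.
move=> [m [v ->]].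
pose b j : R := \sum_i `|ratr (v i 0 j)|.
pose B := \max_(j < n) Num.bound (b j).
have [box boxP] := int_box n B.
exists [seq a <- box | `[< convex_hull (fun i => map_mx ratr (v i)) (int_point R a) >]].
move=> a; rewrite mem_filter; split=> [Pa|/andP[/asboolP]//].
apply/andP; split; first exact/asboolP.
apply: boxP => j; case: Pa => c [c0 c1 aE].
have cle i : c i <= 1 by rewrite -c1 (bigD1 i) //= lerDl sumr_ge0.
have aj : `|(a 0 j)%:~R : R| <= b j.
  have -> : (a 0 j)%:~R = \sum_i c i * ratr (v i 0 j) :> R.
    have /rowP/(_ j) := aE; rewrite mxE => ->; rewrite summxE.
    by apply: eq_bigr => i _; rewrite !mxE.
  apply: le_trans (ler_norm_sum _ _ _) _; apply: ler_sum => i _.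
  by rewrite normrM ger0_norm // ler_piMl.
have : `|(a 0 j)%:~R : R| < (Num.bound (b j))%:R.
  by apply: le_lt_trans aj _; apply: archi_boundP; rewrite sumr_ge0.
rewrite -intr_norm -[X in _ < X]/((Num.bound (b j))%:Z%:~R) ltr_int => aB.
apply: (@leq_trans (Num.bound (b j))); last exact: leq_bigmax.
by move: (a 0 j) (Num.bound _) aB => x y; lia.
Qed.

End RationalCones.

Lemma cone_hyperplanes (R : realType) (s : nat) (P : set 'rV[R]_s) :
  rational_polytope P ->
  exists (m : nat) (L : 'M[int]_(s + 1, m)),
    cone P = [set x | forall j, 0 <= (x *m map_mx intr L) 0 j] /\
    interior (cone P) = [set x | forall j, 0 < (x *m map_mx intr L) 0 j].
Proof.
move=> /rational_polytope_int_points[us usP].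
apply: (conic_hull_matrix (us := [seq row_mx a (const_mx 1) | a <- us])).
have E a : int_point R (row_mx a (const_mx 1 : 'rV[int]_1)) =
           row_mx (int_point R a) (const_mx 1).
  by rewrite /int_point map_row_mx map_const_mx.
move=> x; split=> [[a /= Pa <-]|[_ /mapP[a aus ->] ->]].
  exists (row_mx a (const_mx 1)); last by rewrite E.
  by apply/mapP; exists a => //; apply/usP.
by exists a; [exact/usP|rewrite E].
Qed.

(** * Inversion of the variables in a fraction *)

Section SubstInv.
Variables (C : fieldType) (n : nat).
Implicit Types (p q : mpoly n C) (M : multinom n) (f : formal_series C n).
Local Notation "p %:F" := (@FracField.tofrac (mpoly n C) p).

Lemma fraction_repr (r : {fraction (mpoly n C)}) :
  r = (frac (repr r)).1%:F / (frac (repr r)).2%:F.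
Proof.
have d0 : (frac (repr r)).2%:F != 0 by rewrite tofrac_eq0 denom_ratioP.
apply: (mulIf d0); rewrite divfK //; move: (repr r) (reprK r) {d0} => x <-.
unlock FracField.tofrac; rewrite -[LHS]FracField.pi_mul; apply/eqmodP => /=.
rewrite /FracField.equivf /FracField.mulf !numden_Ratio ?mulf_neq0 ?oner_neq0 ?denom_ratioP //.
by rewrite !mulr1 mulrC.
Qed.

Definition degree_bound M p : Prop :=
  forall m, m \in msupp p -> forall i, (m i <= M i)%N.

Lemma degree_bound_exists p q : exists M, degree_bound M p /\ degree_bound M q.
Proof.
pose s := msupp p ++ msupp q.
pose B := \max_(m <- s) \max_(i < n) m i.
have bound m : m \in s -> forall i, (m i <= B)%N.
  move=> sm i; apply: bigmaxn_sup_seq sm _ _ => //; exact: (leq_bigmax i).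
exists (Multinom [tuple B | i < n]).
by split=> m mp i; rewrite mnmE; apply: bound; rewrite mem_cat mp ?orbT.
Qed.

(** The polynomial z^M p(1/z). *)
Definition reverse_mpoly M p : mpoly n C :=
  \sum_(m <- msupp p) mcoeff m p *: mpolyX C (mnm_sub M m).

Lemma mul_series_reverse M p f b : degree_bound M p ->
  mpoly_mul_series (reverse_mpoly M p) (fun a => f (- a)) b =
  mpoly_mul_series p f (int_expo M - b).
Proof.
move=> Mp; rewrite mul_series_monomials /mpoly_mul_series big_seq [RHS]big_seq.
apply: eq_bigr => m mp; congr (_ * f _); apply/rowP => i; rewrite !mxE mnmBE.
by have := Mp _ mp i; move: (b 0 i) => x; lia.
Qed.

Lemma series_of_reverse M p b : degree_bound M p ->
  series_of_mpoly (reverse_mpoly M p) b = series_of_mpoly p (int_expo M - b).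
Proof.
move=> Mp; rewrite !series_of_mpolyE -mul_series_reverse //.
by congr mpoly_mul_series; apply/funext => a; rewrite oppr_eq0.
Qed.

Lemma reverse_mpoly_eq0 M p : degree_bound M p -> reverse_mpoly M p = 0 -> p = 0.
Proof.
move=> Mp r0; apply: series_of_mpoly_inj; apply/funext => b.
rewrite -[b](subKr (int_expo M)) -series_of_reverse // r0.
by rewrite /series_of_mpoly msupp0 !big_nil.
Qed.

Lemma mpoly_subst_inv_reverse M p : degree_bound M p ->
  mpoly_subst_inv p = (reverse_mpoly M p)%:F / (mpolyX C M)%:F.
Proof.
move=> Mp; have X0 m : (mpolyX C m)%:F != 0.
  by rewrite tofrac_eq0 -msupp_eq0 msuppX.
apply: (mulIf (X0 M)); rewrite divfK // /mpoly_subst_inv /mmap.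
rewrite mulr_suml /reverse_mpoly raddf_sum /= big_seq [RHS]big_seq.
apply: eq_bigr => m mp; rewrite -mul_mpolyC tofracM -mulrA; congr (_ * _).
have -> : mmap1 (fun i => ((mpolyX C (mnm1 i))%:F)^-1) m = ((mpolyX C m)%:F)^-1.
  rewrite mpolyXE_id rmorph_prod /mmap1 -prodfV /=.
  by apply: eq_bigr => i _; rewrite rmorphXn exprVn.
apply: (mulfI (X0 m)); rewrite mulVKf // -tofracM -mpolyXD; congr (mpolyX C _)%:F.
by apply/mnmP => i; rewrite mnmDE mnmBE subnKC // Mp.
Qed.

Lemma mpoly_subst_invM p q :
  mpoly_subst_inv (p * q) = mpoly_subst_inv p * mpoly_subst_inv q.
Proof.
exact: (mmap_is_multiplicative _ (@FracField.tofrac _ \o @mpolyC n C)).1.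
Qed.

Lemma mpoly_subst_inv_neq0 p : p != 0 -> mpoly_subst_inv p != 0.
Proof.
move=> p0; have [M [Mp _]] := degree_bound_exists p p.
rewrite (mpoly_subst_inv_reverse Mp) mulf_neq0 ?invr_eq0 ?tofrac_eq0 //.
  by apply: contra_neq p0; exact: reverse_mpoly_eq0.
by rewrite -msupp_eq0 msuppX.
Qed.

Lemma subst_inv_frac p q : q != 0 ->
  subst_inv (p%:F / q%:F) = mpoly_subst_inv p / mpoly_subst_inv q.
Proof.
move=> q0; set r := _ / _; rewrite /subst_inv.
have d0 : (frac (repr r)).2 != 0 by exact: denom_ratioP.
have e : p * (frac (repr r)).2 = (frac (repr r)).1 * q.
  apply/eqP; rewrite -tofrac_eq !tofracM -eqr_div ?tofrac_eq0 //.
  by rewrite -fraction_repr.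
apply/eqP; rewrite eqr_div ?mpoly_subst_inv_neq0 //.
by rewrite -!mpoly_subst_invM e.
Qed.

(** The reversed numerator and denominator of f serve for the reflected series
    f(-a), and a torsion series does not affect the fraction. *)
Lemma subst_inv_represents f g (c : C) F G :
  quasi_trivial false (fun a => f (- a) - c * g a) ->
  represents f F -> represents g G ->
  subst_inv F = (mpolyC n c)%:F * G.
Proof.
move=> [Q Q0 [_ [[//|->] Qfg]]] [p1 [q1 [q10 qf ->]]] [p2 [q2 [q20 qg ->]]].
have [M [Mp Mq]] := degree_bound_exists p1 q1.
rewrite subst_inv_frac // (mpoly_subst_inv_reverse Mp) (mpoly_subst_inv_reverse Mq).
have X0 : (mpolyX C M)%:F != 0 by rewrite tofrac_eq0 -msupp_eq0 msuppX.
have r0 : reverse_mpoly M q1 != 0.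
  by apply: contra_neq q10; exact: reverse_mpoly_eq0.
rewrite invfM invrK mulrACA mulVf // mulr1 mulrA -tofracM.
apply/eqP; rewrite eqr_div ?tofrac_eq0 // -!tofracM tofrac_eq; apply/eqP.
apply: (mulfI Q0); apply: series_of_mpoly_inj.
pose fm a := f (- a).
have Qf : mpoly_mul_series Q fm = (fun a => c * mpoly_mul_series Q g a).
  apply/funext => a; have := Qfg a isT.
  have -> : (fun a => f (- a) - c * g a) = (fun a => (- c) * g a + fm a).
    by apply/funext => b; rewrite mulNr addrC.
  by rewrite mul_series_lin mulNr addrC => /eqP; rewrite subr_eq0 => /eqP.
have rf : mpoly_mul_series (reverse_mpoly M q1) fm = series_of_mpoly (reverse_mpoly M p1).
  by apply/funext => b; rewrite mul_series_reverse // qf -series_of_reverse.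
have scale q k : mpoly_mul_series q (fun a => c * k a) =
    mpoly_mul_series (mpolyC n c * q) k.
  apply/funext => b; rewrite mul_seriesA.
  rewrite -[mpolyC n c]mulr1 mul_mpolyC -mpolyX0 mul_seriesZX.
  have -> : b - int_expo (mnm0 : multinom n) = b.
    by apply/rowP => i; rewrite !mxE mnm0E subr0.
  by rewrite /mpoly_mul_series mulr_sumr; apply: eq_bigr => m _; rewrite mulrCA.
transitivity (mpoly_mul_series (q2 * reverse_mpoly M q1) (mpoly_mul_series Q fm)).
  rewrite -mul_seriesA [RHS](congr1 (fun q => mpoly_mul_series q fm)
    (_ : _ = (Q * q2) * reverse_mpoly M q1)); last by ring.
  rewrite mul_seriesA rf mul_series_of_mpoly; congr series_of_mpoly; ring.
rewrite Qf scale -mul_seriesA.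
rewrite [LHS](congr1 (fun q => mpoly_mul_series q g)
    (_ : _ = (Q * mpolyC n c * reverse_mpoly M q1) * q2)); last by ring.
rewrite mul_seriesA qg mul_series_of_mpoly; congr series_of_mpoly; ring.
Qed.

End SubstInv.

(** * Ehrhart series as weighted regions *)

Lemma ehrhart_series_region (R : realType) s (P : set 'rV[R]_s) h m
    (L : 'M[int]_(s + 1, m)) :
  cone P = [set x | forall j, 0 <= (x *m map_mx intr L) 0 j] ->
  ehrhart_series P h = (fun a => h a * region R[i] L xpredT a).
Proof.
move=> coneE; apply/funext => a; rewrite /ehrhart_series /region coneE.
case: ifPn => [/set_mem/= pos|/negP npos].
  rewrite (_ : [forall j, _]) ?mulr1 //; apply/forallP => j.
  by have := pos j; rewrite -map_mxM mxE ler0z => ->.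
case: forallP => [pos|]; last by rewrite mulr0.
by case: npos; apply/mem_set => j; rewrite -map_mxM mxE ler0z; have /eqP := pos j.
Qed.

(** The half-open convention forces the opposite matrix: the open cone of L is
    the negative region of -L. *)
Lemma interior_ehrhart_series_region (R : realType) s (P : set 'rV[R]_s) h m
    (L : 'M[int]_(s + 1, m)) :
  interior (cone P) = [set x | forall j, 0 < (x *m map_mx intr L) 0 j] ->
  interior_ehrhart_series P h = (fun a => h (- a) * region R[i] (- L) xpred0 a).
Proof.
move=> coneE; apply/funext => a.
rewrite /interior_ehrhart_series /region coneE.
have negE j : (0 <= (a *m - L) 0 j) = ~~ (0 < (a *m L) 0 j).
  by rewrite mulmxN mxE oppr_ge0 leNgt.
case: ifPn => [/set_mem/= pos|/negP npos].
  rewrite (_ : [forall j, _]) ?mulr1 //; apply/forallP => j.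
  by have := pos j; rewrite -map_mxM mxE ltr0z negE => ->.
case: forallP => [pos|]; last by rewrite mulr0.
case: npos; apply/mem_set => j; rewrite -map_mxM mxE ltr0z; have := pos j.
by rewrite negE eqbF_neg negbK.
Qed.

Theorem theorem2p10 (R : realType) (s : nat) (P : set 'rV[R]_s)
    (k : 'I_(s + 1) -> nat)
    (p : forall i : 'I_(s + 1), 'I_(k i) -> {poly R[i]})
    (g : forall i : 'I_(s + 1), 'I_(k i) -> R[i])
    (hP : rational_polytope P)
    (hg : forall (i : 'I_(s + 1)) (j : 'I_(k i)), g i j != 0) :
  let h := exp_poly_weight p g in
  [/\ is_rational (ehrhart_series P h),
      is_rational (interior_ehrhart_series P h)
    & interior (cone P) !=set0 ->
      forall F Fint : {fraction (mpoly (s + 1) R[i])},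
        represents (ehrhart_series P h) F ->
        represents (interior_ehrhart_series P h) Fint ->
        subst_inv F = (-1) ^+ (s + 1) * Fint].
Proof.
move=> h; have [m [L [coneE intE]]] := cone_hyperplanes hP.
have fE := ehrhart_series_region h coneE.
have gE := interior_ehrhart_series_region h intE.
have hadm fin : admissible fin h by exact: admissible_exp_poly.
have hNadm fin : admissible fin (fun a => h (- a)).
  have -> : (fun a => h (- a)) =
      exp_poly_weight (fun i j => p i j \Po (- 'X)) (fun i j => (g i j)^-1).
    by apply/funext => a; exact: exp_poly_weightN.
  by apply: admissible_exp_poly => i j; rewrite invr_eq0.
split.
- by rewrite fE; apply/is_rational_quasi_trivial/hadm; exact: region_rational.
- by rewrite gE; apply/is_rational_quasi_trivial/hNadm; exact: region_rational.
rewrite intE => -[w w0] F Fint repF repFint.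
have -> : (-1) ^+ (s + 1) =
    FracField.tofrac (mpolyC (s + 1) ((-1) ^+ (s + 1))) :> {fraction (mpoly (s + 1) R[i])}.
  by rewrite !rmorphXn !rmorphN1.
apply: subst_inv_represents repF repFint; rewrite fE gE.
have w0' j : 0 < (- w *m map_mx intr (- L)) 0 j.
  by rewrite map_mxN mulmxN mulNmx opprK; exact: w0.
have := hNadm false _ (region_reciprocity R[i] xpredT w0').
congr quasi_trivial; apply/funext => a; rewrite mulrBr [_ * (_ * region _ _ _ _)]mulrCA.
by congr (_ * _ - _); rewrite /region mulNmx mulmxN.
Qed.
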